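(* Let $\mathbb K$ be a field and $A$ a unitary commutative $\mathbb K$-algebra. (a) There is a one-to-one correspondence between strict pre-Lie-Rinehart $2$-algebras over $A$ and crossed modules for pre-Lie-Rinehart algebras over $A$. (b) There is a one-to-one correspondence between strict Lie-Rinehart $2$-algebras over $A$ and crossed modules for Lie-Rinehart algebras over $A$.
   Context: $\mathrm{Der}(A)$: $\mathbb K$-linear derivations of $A$, with commutator $[-,-]^c$. **Lie-Rinehart side.** A Lie-Rinehart algebra $(E,[-,-]_E,\theta_E)$ over $A$: an $A$-module $E$, an $A$-module map $\theta_E:E\to\mathrm{Der}(A)$ and a $\mathbb K$-Lie bracket with $[X,aY]_E=a[X,Y]_E+\theta_E(X)(a)Y$, $\theta_E([X,Y]_E)=[\theta_E(X),\theta_E(Y)]^c$. A representation of it on an $A$-module $\mathcal E$: an $A$-linear assignment $X\mapsto\rho(X)\in\mathrm{End}_{\mathbb K}(\mathcal E)$ with $\rho(X)(au)=a\rho(X)u+\theta_E(X)(a)u$, $\rho([X,Y]_E)=[\rho(X),\rho(Y)]^c$. A crossed module for Lie-Rinehart algebras $(E,\mathcal E,\partial,\rho)$: a Lie-Rinehart algebra $E$, a Lie $\mathbb K$-algebra $(\mathcal E,[-,-]_{\mathcal E})$ which is an $A$-module, a representation $\rho$ of $E$ on $\mathcal E$, and an $A$-linear Lie algebra homomorphism $\partial:\mathcal E\to E$ with $\partial(\rho(X)u)=[X,\partial(u)]_E$, $\rho(\partial(u))v=[u,v]_{\mathcal E}$, $\theta_E\circ\partial=0$, $\rho(X)[u,v]_{\mathcal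 E}=[\rho(X)u,v]_{\mathcal E}+[u,\rho(X)v]_{\mathcal E}$. A strict Lie $\mathbb K$-$2$-algebra (a Lie $2$-algebra with $l_3=0$): a complex of $\mathbb K$-vector spaces $l_1:L_1\to L_0$ and a skew-symmetric bilinear map $l_2:L_i\otimes L_j\to L_{i+j}$, $0\le i+j\le1$, with, for $x,y,z\in L_0$, $u,v\in L_1$: $l_1l_2(x,u)=l_2(x,l_1(u))$, $l_2(l_1(u),v)=l_2(u,l_1(v))$, $l_2(x,l_2(y,z))+l_2(z,l_2(x,y))+l_2(y,l_2(z,x))=0$, $l_2(x,l_2(y,u))+l_2(u,l_2(x,y))+l_2(y,l_2(u,x))=0$. A strict Lie-Rinehart $2$-algebra $(L_0,L_1,l_1,l_2,l_3=0,\theta)$ over $A$: a strict Lie $\mathbb K$-$2$-algebra with an $A$-module structure on $L_0\oplus L_1$ (i.e. on $L_0$ and $L_1$) and an $A$-module map $\theta:L_0\to\mathrm{Der}(A)$ such that $l_2(X^0,aY)=al_2(X^0,Y)+\theta(X^0)(a)Y$ for $a\in A$, $X^0\in L_0$, $Y\in L_0\oplus L_1$; $l_1$ is $A$-linear; $\theta(l_2(X^0,Y^0))=[\theta(X^0),\theta(Y^0)]^c$ for $X^0,Y^0\in L_0$; $\theta\circ l_1=0$. **Pre-Lie side.** A pre-Lie $\mathbb K$-algebra: a vector space with bilinear product whose associator $(x,y,z)=x(yz)-(xy)z$ is symmetric in $x,y$. A pre-Lie-Rinehart algebra $(E,\cdot_E,\theta_E)$ over $A$: an $A$-module with an $A$-module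 map $\theta_E:E\to\mathrm{Der}(A)$ and a pre-Lie product with $X\cdot_E(aY)=a(X\cdot_EY)+\theta_E(X)(a)Y$, $(aX)\cdot_EY=a(X\cdot_EY)$, $\theta_E([X,Y]_E)=[\theta_E(X),\theta_E(Y)]^c$, where $[X,Y]_E=X\cdot_EY-Y\cdot_EX$. A representation $(\rho,\mu)$ on an $A$-module $\mathcal E$: $\rho$ a representation of the Lie-Rinehart algebra $(E,[-,-]_E,\theta_E)$ on $\mathcal E$, and $\mu:E\to\mathrm{Hom}_A(\mathcal E,\mathcal E)$ $A$-linear with $\rho(X)\mu(Y)-\mu(Y)\rho(X)=\mu(X\cdot_EY)-\mu(Y)\mu(X)$. A crossed module for pre-Lie-Rinehart algebras $(E,\mathcal E,\partial,(\rho,\mu))$: a pre-Lie-Rinehart algebra $E$, a pre-Lie $\mathbb K$-algebra $(\mathcal E,\cdot_{\mathcal E})$ which is an $A$-module, a representation $(\rho,\mu)$ of $E$ on $\mathcal E$ and an $A$-linear pre-Lie homomorphism $\partial:\mathcal E\to E$ with $\partial(\rho(X)u)=X\cdot_E\partial(u)$, $\partial(\mu(X)u)=\partial(u)\cdot_EX$, $\rho(\partial(u))v=\mu(\partial(v))u=u\cdot_{\mathcal E}v$, $\theta_E\circ\partial=0$. A strict pre-Lie $\mathbb K$-$2$-algebra (a pre-Lie $2$-algebra with $m_3=0$): a complex $m_1:P_1\to P_0$ of $\mathbb K$-vector spaces and bilinear maps $m_2:P_i\otimes P_j\to P_{i+j}$, $0\le i+j\le1$, such that for $x,y,z\in P_0$,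 $m,n\in P_1$: $m_1m_2(x,m)=m_2(x,m_1(m))$; $m_1m_2(m,x)=m_2(m_1(m),x)$; $m_2(m_1(m),n)=m_2(m,m_1(n))$; and $m_2(x,m_2(y,z))-m_2(m_2(x,y),z)-m_2(y,m_2(x,z))+m_2(m_2(y,x),z)=0$, together with the two identities obtained from it by replacing $z$ by $m\in P_1$, respectively by replacing $(x,y,z)$ by $(m,x,y)$. A strict pre-Lie-Rinehart $2$-algebra $(P_0,P_1,m_1,m_2,m_3=0,\theta)$ over $A$: a strict pre-Lie $\mathbb K$-$2$-algebra with an $A$-module structure on $P_0\oplus P_1$ (i.e. on $P_0$ and $P_1$) and an $A$-module map $\theta:P_0\to\mathrm{Der}(A)$ such that for $a\in A$, $X^0,Y^0\in P_0$, $X^1\in P_1$: $m_2(X^0,aY)=am_2(X^0,Y)+\theta(X^0)(a)Y$ and $m_2(aX^0,Y)=am_2(X^0,Y)$ for $Y\in P_0\oplus P_1$; $m_2(X^1,aY^0)=m_2(aX^1,Y^0)=am_2(X^1,Y^0)$; $m_1$ is $A$-linear; $\theta(m_2(X^0,Y^0)-m_2(Y^0,X^0))=[\theta(X^0),\theta(Y^0)]^c$; $\theta\circ m_1=0$. **Correspondences.** In (a), $(P_0,P_1,m_1,m_2,0,\theta)$ corresponds to $E=P_0$ with $X^0\cdot Y^0=m_2(X^0,Y^0)$ and anchor $\theta$, $\mathcal E=P_1$ with $X^1\cdot Y^1=m_2(m_1(X^1),Y^1)=m_2(X^1,m_1(Y^1))$, $\partial=m_1$, $\rho(X^0)(Y^1)=m_2(X^0,Y^1)$,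 $\mu(X^0)(Y^1)=m_2(Y^1,X^0)$. In (b), similarly, $(L_0,L_1,l_1,l_2,0,\theta)$ corresponds to $E=L_0$ with bracket $l_2$ and anchor $\theta$, $\mathcal E=L_1$ with $[X^1,Y^1]=l_2(l_1(X^1),Y^1)$, $\partial=l_1$, $\rho(X^0)(Y^1)=l_2(X^0,Y^1)$.
   Formalization: In (b), strict Lie-Rinehart 2-algebras are also required to satisfy l_2(aX^0,Y^1)=a l_2(X^0,Y^1), without which the prescribed ρ need not be A-linear and the claim fails; Lie brackets are skew in the sense [x,y]=-[y,x], also in characteristic 2. *)

(* Defs.v *)
From HB Require Import structures.
From mathcomp Require Import all_boot all_order all_algebra.

Set Implicit Arguments.
Unset Strict Implicit.
Unset Printing Implicit Defensive.

Import GRing.Theory.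
Local Open Scope ring_scope.

(* The commutative K-algebra A is given by its structure morphism
   iota : K -> A, which (unlike comAlgType) does not exclude the zero ring. An
   A-module is a K-vector space by restriction of scalars along iota; this is
   the K-structure for which K-bilinearity is meant throughout. *)
Definition restr (K : fieldType) (A : comPzRingType) (iota : {rmorphism K -> A})
  (V : lmodType A) : Type := V.

Section Restriction.
Variables (K : fieldType) (A : comPzRingType) (iota : {rmorphism K -> A}).
Variable V : lmodType A.

HB.instance Definition _ := GRing.Zmodule.on (restr iota V).

Definition restr_scale (k : K) (v : restr iota V) : restr iota V :=
  iota k *: (v : V).

Fact restr_scaleA k l v :
  restr_scale k (restr_scale l v) = restr_scale (k * l) v.
Proof. by rewrite /restr_scale scalerA rmorphM. Qed.
Fact restr_scale1 : left_id 1 restr_scale.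
Proof. by move=> v; rewrite /restr_scale rmorph1 scale1r. Qed.
Fact restr_scaleDr : right_distributive restr_scale +%R.
Proof. by move=> k u v; rewrite /restr_scale scalerDr. Qed.
Fact restr_scaleDl v : {morph restr_scale^~ v : k l / k + l}.
Proof. by move=> k l; rewrite /restr_scale rmorphD scalerDl. Qed.

HB.instance Definition _ := GRing.Zmodule_isLmodule.Build K (restr iota V)
  restr_scaleA restr_scale1 restr_scaleDr restr_scaleDl.
End Restriction.

Definition bilin (K : fieldType) (U V W : lmodType K) (f : U -> V -> W) : Prop :=
  bilinear_for *:%R *:%R f.

Section Algebras.
Variable K : fieldType.

(* Skew-symmetry is [x, y] = - [y, x], also in characteristic 2. *)
Record lie_algebra (V : lmodType K) (br : V -> V -> V) : Prop := {
  lie_bilin : bilin br;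
  lie_skew : forall x y, br x y = - br y x;
  lie_jacobi : forall x y z,
    br x (br y z) + br z (br x y) + br y (br z x) = 0
}.

Definition associator (V : lmodType K) (m : V -> V -> V) (x y z : V) : V :=
  m x (m y z) - m (m x y) z.

Record prelie_algebra (V : lmodType K) (m : V -> V -> V) : Prop := {
  prelie_bilin : bilin m;
  prelie_assoc : forall x y z, associator m x y z = associator m y x z
}.

(* In the 2-algebras below, the suffix ij marks the component
   L_i x L_j -> L_(i+j) of the binary operation; there is no component on
   L_1 x L_1. *)
Record strict_lie2 (L0 L1 : lmodType K) (l1 : L1 -> L0)
    (l00 : L0 -> L0 -> L0) (l01 : L0 -> L1 -> L1) (l10 : L1 -> L0 -> L1)
    : Prop := {
  lie2_linear : linear l1;
  lie2_bilin00 : bilin l00;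
  lie2_bilin01 : bilin l01;
  lie2_bilin10 : bilin l10;
  lie2_skew00 : forall x y, l00 x y = - l00 y x;
  lie2_skew10 : forall u x, l10 u x = - l01 x u;
  lie2_chain : forall x u, l1 (l01 x u) = l00 x (l1 u);
  lie2_peiffer : forall u v, l01 (l1 u) v = l10 u (l1 v);
  lie2_jacobi0 : forall x y z,
    l00 x (l00 y z) + l00 z (l00 x y) + l00 y (l00 z x) = 0;
  lie2_jacobi1 : forall x y u,
    l01 x (l01 y u) + l10 u (l00 x y) + l01 y (l10 u x) = 0
}.

Record strict_prelie2 (P0 P1 : lmodType K) (m1 : P1 -> P0)
    (m00 : P0 -> P0 -> P0) (m01 : P0 -> P1 -> P1) (m10 : P1 -> P0 -> P1)
    : Prop := {
  prelie2_linear : linear m1;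
  prelie2_bilin00 : bilin m00;
  prelie2_bilin01 : bilin m01;
  prelie2_bilin10 : bilin m10;
  prelie2_chain01 : forall x u, m1 (m01 x u) = m00 x (m1 u);
  prelie2_chain10 : forall u x, m1 (m10 u x) = m00 (m1 u) x;
  prelie2_peiffer : forall u v, m01 (m1 u) v = m10 u (m1 v);
  prelie2_assoc000 : forall x y z,
    m00 x (m00 y z) - m00 (m00 x y) z - m00 y (m00 x z) + m00 (m00 y x) z = 0;
  prelie2_assoc001 : forall x y u,
    m01 x (m01 y u) - m01 (m00 x y) u - m01 y (m01 x u) + m01 (m00 y x) u = 0;
  prelie2_assoc100 : forall u x y,
    m10 u (m00 x y) - m10 (m10 u x) y - m01 x (m10 u y) + m10 (m01 x u) y = 0
}.

End Algebras.

Section Rinehart.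
Variables (K : fieldType) (A : comPzRingType) (iota : {rmorphism K -> A}).

Record derivation (D : A -> A) : Prop := {
  der_linear : linear (D : restr iota A^o -> restr iota A^o);
  der_leibniz : forall a b, D (a * b) = a * D b + D a * b
}.

(* theta is an A-linear map into Der(A), whose A-module structure is
   pointwise. *)
Record anchor (E : lmodType A) (theta : E -> A -> A) : Prop := {
  anchor_der : forall X, derivation (theta X);
  anchor_linear : forall a X Y b,
    theta (a *: X + Y) b = a * theta X b + theta Y b
}.

Definition anchor_morph (E : lmodType A) (br : E -> E -> E)
    (theta : E -> A -> A) : Prop :=
  forall X Y a, theta (br X Y) a = theta X (theta Y a) - theta Y (theta X a).

Record lie_rinehart (E : lmodType A) (br : E -> E -> E)
    (theta : E -> A -> A) : Prop := {
  lr_lie : lie_algebra (V := restr iota E) br;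
  lr_anchor : anchor theta;
  lr_leibniz : forall X a Y, br X (a *: Y) = a *: br X Y + theta X a *: Y;
  lr_morph : anchor_morph br theta
}.

Record lr_representation (E : lmodType A) (br : E -> E -> E)
    (theta : E -> A -> A) (M : lmodType A) (rho : E -> M -> M) : Prop := {
  rep_Klinear : forall X, linear (rho X : restr iota M -> restr iota M);
  rep_linear : forall u, linear (rho^~ u);
  rep_leibniz : forall X a u,
    rho X (a *: u) = a *: rho X u + theta X a *: u;
  rep_morph : forall X Y u,
    rho (br X Y) u = rho X (rho Y u) - rho Y (rho X u)
}.

Record lr_crossed_on (E M : lmodType A) := LrCrossedOn {
  lrc_br : E -> E -> E;
  lrc_theta : E -> A -> A;
  lrc_brM : M -> M -> M;
  lrc_d : M -> E;
  lrc_rho : E -> M -> M;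
  lrc_lr : lie_rinehart lrc_br lrc_theta;
  lrc_lie : lie_algebra (V := restr iota M) lrc_brM;
  lrc_rep : lr_representation lrc_br lrc_theta lrc_rho;
  lrc_d_linear : linear lrc_d;
  lrc_d_morph : forall u v, lrc_d (lrc_brM u v) = lrc_br (lrc_d u) (lrc_d v);
  lrc_d_rho : forall X u, lrc_d (lrc_rho X u) = lrc_br X (lrc_d u);
  lrc_rho_d : forall u v, lrc_rho (lrc_d u) v = lrc_brM u v;
  lrc_theta_d : forall u a, lrc_theta (lrc_d u) a = 0;
  lrc_rho_der : forall X u v,
    lrc_rho X (lrc_brM u v) =
    lrc_brM (lrc_rho X u) v + lrc_brM u (lrc_rho X v)
}.

Record lr_crossed := LrCrossed {
  lrc_E : lmodType A;
  lrc_M : lmodType A;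
  lrc_str :> lr_crossed_on lrc_E lrc_M
}.

(* lr2_leibniz10 is the Leibniz rule with first argument of degree 1, where the
   anchor is zero; by lie2_skew10 it says that l2(aX, u) = a l2(X, u), which
   lr2_leibniz01 does not imply. *)
Record strict_lr2_on (L0 L1 : lmodType A) := StrictLr2On {
  lr2_l1 : L1 -> L0;
  lr2_00 : L0 -> L0 -> L0;
  lr2_01 : L0 -> L1 -> L1;
  lr2_10 : L1 -> L0 -> L1;
  lr2_theta : L0 -> A -> A;
  lr2_lie2 : strict_lie2 (L0 := restr iota L0) (L1 := restr iota L1)
    lr2_l1 lr2_00 lr2_01 lr2_10;
  lr2_anchor : anchor lr2_theta;
  lr2_leibniz00 : forall X a Y,
    lr2_00 X (a *: Y) = a *: lr2_00 X Y + lr2_theta X a *: Y;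
  lr2_leibniz01 : forall X a u,
    lr2_01 X (a *: u) = a *: lr2_01 X u + lr2_theta X a *: u;
  lr2_leibniz10 : forall u a X, lr2_10 u (a *: X) = a *: lr2_10 u X;
  lr2_l1_linear : linear lr2_l1;
  lr2_morph : anchor_morph lr2_00 lr2_theta;
  lr2_theta_l1 : forall u a, lr2_theta (lr2_l1 u) a = 0
}.

Record strict_lr2 := StrictLr2 {
  lr2_L0 : lmodType A;
  lr2_L1 : lmodType A;
  lr2_str :> strict_lr2_on lr2_L0 lr2_L1
}.

Record lr_corresponds (L0 L1 : lmodType A) (S : strict_lr2_on L0 L1)
    (C : lr_crossed_on L0 L1) : Prop := {
  lr_corr_br : forall X Y, lrc_br C X Y = lr2_00 S X Y;
  lr_corr_theta : forall X a, lrc_theta C X a = lr2_theta S X a;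
  lr_corr_brM : forall u v, lrc_brM C u v = lr2_01 S (lr2_l1 S u) v;
  lr_corr_d : forall u, lrc_d C u = lr2_l1 S u;
  lr_corr_rho : forall X u, lrc_rho C X u = lr2_01 S X u
}.

Definition commutator (E : lmodType A) (m : E -> E -> E) (X Y : E) : E :=
  m X Y - m Y X.

Record prelie_rinehart (E : lmodType A) (m : E -> E -> E)
    (theta : E -> A -> A) : Prop := {
  plr_prelie : prelie_algebra (V := restr iota E) m;
  plr_anchor : anchor theta;
  plr_leibniz : forall X a Y, m X (a *: Y) = a *: m X Y + theta X a *: Y;
  plr_linear : forall a X Y, m (a *: X) Y = a *: m X Y;
  plr_morph : anchor_morph (commutator m) theta
}.

Record plr_representation (E : lmodType A) (m : E -> E -> E)
    (theta : E -> A -> A) (M : lmodType A) (rho mu : E -> M -> M) : Prop := {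
  prep_rho : lr_representation (commutator m) theta rho;
  prep_mu_Hom : forall X, linear (mu X);
  prep_mu_linear : forall u, linear (mu^~ u);
  prep_rho_mu : forall X Y u,
    rho X (mu Y u) - mu Y (rho X u) = mu (m X Y) u - mu Y (mu X u)
}.

Record plr_crossed_on (E M : lmodType A) := PlrCrossedOn {
  plrc_mul : E -> E -> E;
  plrc_theta : E -> A -> A;
  plrc_mulM : M -> M -> M;
  plrc_d : M -> E;
  plrc_rho : E -> M -> M;
  plrc_mu : E -> M -> M;
  plrc_plr : prelie_rinehart plrc_mul plrc_theta;
  plrc_prelie : prelie_algebra (V := restr iota M) plrc_mulM;
  plrc_rep : plr_representation plrc_mul plrc_theta plrc_rho plrc_mu;
  plrc_d_linear : linear plrc_d;
  plrc_d_morph : forall u v,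
    plrc_d (plrc_mulM u v) = plrc_mul (plrc_d u) (plrc_d v);
  plrc_d_rho : forall X u, plrc_d (plrc_rho X u) = plrc_mul X (plrc_d u);
  plrc_d_mu : forall X u, plrc_d (plrc_mu X u) = plrc_mul (plrc_d u) X;
  plrc_rho_d : forall u v, plrc_rho (plrc_d u) v = plrc_mulM u v;
  plrc_mu_d : forall u v, plrc_mu (plrc_d v) u = plrc_mulM u v;
  plrc_theta_d : forall u a, plrc_theta (plrc_d u) a = 0
}.

Record plr_crossed := PlrCrossed {
  plrc_E : lmodType A;
  plrc_M : lmodType A;
  plrc_str :> plr_crossed_on plrc_E plrc_M
}.

Record strict_plr2_on (P0 P1 : lmodType A) := StrictPlr2On {
  plr2_m1 : P1 -> P0;
  plr2_00 : P0 -> P0 -> P0;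
  plr2_01 : P0 -> P1 -> P1;
  plr2_10 : P1 -> P0 -> P1;
  plr2_theta : P0 -> A -> A;
  plr2_prelie2 : strict_prelie2 (P0 := restr iota P0) (P1 := restr iota P1)
    plr2_m1 plr2_00 plr2_01 plr2_10;
  plr2_anchor : anchor plr2_theta;
  plr2_leibniz00 : forall X a Y,
    plr2_00 X (a *: Y) = a *: plr2_00 X Y + plr2_theta X a *: Y;
  plr2_leibniz01 : forall X a u,
    plr2_01 X (a *: u) = a *: plr2_01 X u + plr2_theta X a *: u;
  plr2_linear00 : forall a X Y, plr2_00 (a *: X) Y = a *: plr2_00 X Y;
  plr2_linear01 : forall a X u, plr2_01 (a *: X) u = a *: plr2_01 X u;
  plr2_linear10r : forall u a X, plr2_10 u (a *: X) = a *: plr2_10 u X;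
  plr2_linear10l : forall a u X, plr2_10 (a *: u) X = a *: plr2_10 u X;
  plr2_m1_linear : linear plr2_m1;
  plr2_morph : anchor_morph (commutator plr2_00) plr2_theta;
  plr2_theta_m1 : forall u a, plr2_theta (plr2_m1 u) a = 0
}.

Record strict_plr2 := StrictPlr2 {
  plr2_P0 : lmodType A;
  plr2_P1 : lmodType A;
  plr2_str :> strict_plr2_on plr2_P0 plr2_P1
}.

Record plr_corresponds (P0 P1 : lmodType A) (S : strict_plr2_on P0 P1)
    (C : plr_crossed_on P0 P1) : Prop := {
  plr_corr_mul : forall X Y, plrc_mul C X Y = plr2_00 S X Y;
  plr_corr_theta : forall X a, plrc_theta C X a = plr2_theta S X a;
  plr_corr_mulM : forall u v, plrc_mulM C u v = plr2_01 S (plr2_m1 S u) v;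
  plr_corr_mulM' : forall u v, plrc_mulM C u v = plr2_10 S u (plr2_m1 S v);
  plr_corr_d : forall u, plrc_d C u = plr2_m1 S u;
  plr_corr_rho : forall X u, plrc_rho C X u = plr2_01 S X u;
  plr_corr_mu : forall X u, plrc_mu C X u = plr2_10 S u X
}.

End Rinehart.

(* Main.v *)
Require Import Defs.
From mathcomp Require Import all_boot all_order all_algebra.
From mathcomp Require Import boolp.

Set Implicit Arguments.
Unset Strict Implicit.
Unset Printing Implicit Defensive.

Import GRing.Theory.
Local Open Scope ring_scope.

(** The data of a crossed module and of a strict 2-algebra determine one
    another.  From a 2-algebra the crossed module keeps the degree 0 algebra,
    the anchor, the differential and the mixed operations, read as actions; the
    product on the degree 1 module is the derived product, obtained by pushing
    one argument to degree 0 along the differential.  The Peiffer identity says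
    that either argument may be pushed, and this is what makes the derived
    product skew-symmetric in the Lie case, and computable by both actions in
    the pre-Lie case.  Its Jacobi or associator identity is the mixed identity
    of the 2-algebra evaluated on boundaries
    ([strict_lie2_derived], [strict_prelie2_derived]).

    Conversely, in a crossed module the product on the degree 1 module is
    recovered from the actions by rho (d u) v = u v, so forgetting it loses no
    data, and the remaining axioms regroup to those of a 2-algebra
    ([strict_lie2_of_action], [strict_prelie2_of_action]).

    None of this involves A: it is linear algebra over K.  Over A there remains
    the comparison of linearity conditions: an operation of a 2-algebra is
    K-bilinear and A-homogeneous in the suitable arguments, whereas an action is
    A-linear in them; an additive A-homogeneous map is A-linear
    ([linear_of_restr]), and an A-linear map is K-linear ([linear_restr]).

    Both composites then fix the data: the product on the degree 1 module and,
    in the Lie case, l10 are rebuilt from the actions by formulas which the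
    axioms impose anyway.  Structures with equal data are equal because their
    axioms are propositions ([strict_lr2_on_ext] and its analogues). *)

(** * Restriction of scalars *)

Section RestrictionOfScalars.
Variables (K : fieldType) (A : comPzRingType) (iota : {rmorphism K -> A}).
Variables E M : lmodType A.

Lemma linear_restr (f : E -> M) :
  linear f -> linear (f : restr iota E -> restr iota M).
Proof. by move=> f_lin k; apply: (f_lin (iota k)). Qed.

Lemma linear_of_restr (f : E -> M) :
    linear (f : restr iota E -> restr iota M) ->
  (forall a u, f (a *: u) = a *: f u) -> linear f.
Proof.
move=> /GRing.semilinear_linear[_ fD] fZ a u v.
by rewrite -fZ; apply: fD.
Qed.

End RestrictionOfScalars.

(** * Lie 2-algebras over a field *)

Section LieOverField.
Variable K : fieldType.
Variables (L0 L1 : lmodType K) (l1 : L1 -> L0) (l00 : L0 -> L0 -> L0).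
Variables (l01 : L0 -> L1 -> L1) (l10 : L1 -> L0 -> L1).

Section FromStrictLie2.
Hypothesis L_lie2 : strict_lie2 l1 l00 l01 l10.

Lemma strict_lie2_lie : lie_algebra l00.
Proof. by case: L_lie2. Qed.

(** Skew-symmetry turns the mixed Jacobi identity into the statement that L0
    acts on L1. *)
Lemma strict_lie2_action x y u :
  l01 (l00 x y) u = l01 x (l01 y u) - l01 y (l01 x u).
Proof.
have /(_ y)/GRing.zmod_morphism_linear l01B := (lie2_bilin01 L_lie2).2.
have l01N v : l01 y (- v) = - l01 y v.
  by rewrite -sub0r l01B -[X in l01 y X](subrr 0) l01B subrr sub0r.
have := lie2_jacobi1 L_lie2 x y u.
by rewrite !(lie2_skew10 L_lie2) l01N addrAC => /subr0_eq.
Qed.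

Lemma strict_lie2_derived : lie_algebra (fun u v => l01 (l1 u) v).
Proof.
have [l01l l01r] := lie2_bilin01 L_lie2.
split.
- split=> [v k u u'|u]; last exact: l01r.
  by rewrite (lie2_linear L_lie2) l01l.
- by move=> u v; rewrite (lie2_peiffer L_lie2) (lie2_skew10 L_lie2).
move=> u v w; have := lie2_jacobi1 L_lie2 (l1 u) (l1 v) w.
(* l00 (l1 u) (l1 v) is a boundary, so both values of l10 in the mixed Jacobi
   identity are at boundaries, where the Peiffer identity turns l10 into l01. *)
by rewrite -(lie2_chain L_lie2) -!(lie2_peiffer L_lie2).
Qed.

Lemma strict_lie2_derivation x u v :
  l01 x (l01 (l1 u) v) = l01 (l1 (l01 x u)) v + l01 (l1 u) (l01 x v).
Proof. by rewrite (lie2_chain L_lie2) strict_lie2_action subrK. Qed.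

End FromStrictLie2.

(** The identity d (rho x u) = [x, d u] makes d a chain map, and
    skew-symmetry of (u, v) |-> rho (d u) v is the Peiffer identity. *)
Lemma strict_lie2_of_action :
    linear l1 -> lie_algebra l00 -> bilin l01 ->
    (forall x u, l1 (l01 x u) = l00 x (l1 u)) ->
    (forall u v, l01 (l1 u) v = - l01 (l1 v) u) ->
    (forall x y u, l01 (l00 x y) u = l01 x (l01 y u) - l01 y (l01 x u)) ->
  strict_lie2 l1 l00 l01 (fun u x => - l01 x u).
Proof.
move=> l1_lin [l00_bilin l00_skew l00_jacobi] l01_bilin chain skew action.
have [l01l l01r] := l01_bilin.
split=> //.
- split=> [x k u v|u k x y]; first by rewrite l01r opprD -scalerN.
  by rewrite l01l opprD -scalerN.
- move=> x y u; rewrite action opprB addrCA subrr addr0.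
  have [_ l01D] := GRing.semilinear_linear (l01r y).
  have l010 : l01 y 0 = 0 by apply: (addrI (l01 y 0)); rewrite -l01D !addr0.
  by rewrite -l01D subrr.
Qed.

End LieOverField.

(** * Pre-Lie 2-algebras over a field *)

(** The associator identities of a 2-algebra are written as vanishing sums; this
    is their common reading as an equality of two associators. *)
Lemma sub_sub_add (V : zmodType) (a b c d : V) :
  a - b - c + d = (a - b) - (c - d).
Proof. by rewrite opprB addrA addrAC. Qed.

Section PreLieOverField.
Variable K : fieldType.
Variables (P0 P1 : lmodType K) (m1 : P1 -> P0) (m00 : P0 -> P0 -> P0).
Variables (m01 : P0 -> P1 -> P1) (m10 : P1 -> P0 -> P1).

Section FromStrictPreLie2.
Hypothesis P_prelie2 : strict_prelie2 m1 m00 m01 m10.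

Lemma strict_prelie2_prelie : prelie_algebra m00.
Proof.
split=> [|x y z]; first by case: P_prelie2.
by apply: subr0_eq; rewrite -sub_sub_add; apply: prelie2_assoc000 P_prelie2 _ _ _.
Qed.

Lemma strict_prelie2_derived : prelie_algebra (fun u v => m01 (m1 u) v).
Proof.
have [m01l m01r] := prelie2_bilin01 P_prelie2.
split=> [|u v w].
  split=> [v k u u'|u]; last exact: m01r.
  by rewrite (prelie2_linear P_prelie2) m01l.
apply: subr0_eq; rewrite /associator !(prelie2_chain01 P_prelie2) -sub_sub_add.
exact: prelie2_assoc001 P_prelie2 _ _ _.
Qed.

Lemma strict_prelie2_rho x y u :
  m01 (m00 x y - m00 y x) u = m01 x (m01 y u) - m01 y (m01 x u).
Proof.
have /(_ u)/GRing.zmod_morphism_linear m01B := (prelie2_bilin01 P_prelie2).1.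
rewrite m01B; apply/esym/subr0_eq; rewrite -sub_sub_add [X in X + _]addrAC.
exact: prelie2_assoc001 P_prelie2 _ _ _.
Qed.

Lemma strict_prelie2_rho_mu x y u :
  m01 x (m10 u y) - m10 (m01 x u) y = m10 u (m00 x y) - m10 (m10 u x) y.
Proof.
apply/esym/subr0_eq; rewrite -sub_sub_add.
exact: prelie2_assoc100 P_prelie2 _ _ _.
Qed.

End FromStrictPreLie2.

(** The three associator identities of a 2-algebra are those of m00 and the two
    compatibilities of the pair of actions (m01, m10). *)
Lemma strict_prelie2_of_action :
    linear m1 -> prelie_algebra m00 -> bilin m01 -> bilin m10 ->
    (forall x u, m1 (m01 x u) = m00 x (m1 u)) ->
    (forall u x, m1 (m10 u x) = m00 (m1 u) x) ->
    (forall u v, m01 (m1 u) v = m10 u (m1 v)) ->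
    (forall x y u,
       m01 (m00 x y - m00 y x) u = m01 x (m01 y u) - m01 y (m01 x u)) ->
    (forall x y u,
       m01 x (m10 u y) - m10 (m01 x u) y = m10 u (m00 x y) - m10 (m10 u x) y) ->
  strict_prelie2 m1 m00 m01 m10.
Proof.
move=> m1_lin [m00_bilin assoc] m01_bilin m10_bilin chain01 chain10 peiffer.
move=> rho_comm rho_mu; split=> // [x y z|x y u|u x y]; rewrite sub_sub_add.
- by rewrite -[X in X - _]/(associator m00 x y z) assoc subrr.
- have /(_ u)/GRing.zmod_morphism_linear m01B := m01_bilin.1.
  by rewrite -sub_sub_add [X in X + _]addrAC sub_sub_add -m01B rho_comm subrr.
- by rewrite rho_mu subrr.
Qed.

End PreLieOverField.

(** * Equality of structures with equal data *)

Section Extensionality.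
Variables (K : fieldType) (A : comPzRingType) (iota : {rmorphism K -> A}).
Variables E M : lmodType A.

Lemma strict_lr2_on_ext (S T : strict_lr2_on iota E M) :
    lr2_l1 S = lr2_l1 T -> lr2_00 S = lr2_00 T -> lr2_01 S = lr2_01 T ->
  lr2_10 S = lr2_10 T -> lr2_theta S = lr2_theta T -> S = T.
Proof.
case: S; case: T => /=; intros; subst.
by f_equal; apply: Prop_irrelevance.
Qed.

Lemma lr_crossed_on_ext (C D : lr_crossed_on iota E M) :
    lrc_br C = lrc_br D -> lrc_theta C = lrc_theta D ->
    lrc_brM C = lrc_brM D -> lrc_d C = lrc_d D -> lrc_rho C = lrc_rho D ->
  C = D.
Proof.
case: C; case: D => /=; intros; subst.
by f_equal; apply: Prop_irrelevance.
Qed.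

Lemma strict_plr2_on_ext (S T : strict_plr2_on iota E M) :
    plr2_m1 S = plr2_m1 T -> plr2_00 S = plr2_00 T -> plr2_01 S = plr2_01 T ->
  plr2_10 S = plr2_10 T -> plr2_theta S = plr2_theta T -> S = T.
Proof.
case: S; case: T => /=; intros; subst.
by f_equal; apply: Prop_irrelevance.
Qed.

Lemma plr_crossed_on_ext (C D : plr_crossed_on iota E M) :
    plrc_mul C = plrc_mul D -> plrc_theta C = plrc_theta D ->
    plrc_mulM C = plrc_mulM D -> plrc_d C = plrc_d D ->
    plrc_rho C = plrc_rho D -> plrc_mu C = plrc_mu D ->
  C = D.
Proof.
case: C; case: D => /=; intros; subst.
by f_equal; apply: Prop_irrelevance.
Qed.

End Extensionality.

(** * Lie-Rinehart 2-algebras and crossed modules *)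

Section LieRinehart.
Variables (K : fieldType) (A : comPzRingType) (iota : {rmorphism K -> A}).
Variables E M : lmodType A.

Section CrossedOfStrict.
Variable S : strict_lr2_on iota E M.
Let S_lie2 := lr2_lie2 S.

Lemma strict_lr2_lie_rinehart : lie_rinehart iota (lr2_00 S) (lr2_theta S).
Proof.
split; first exact: strict_lie2_lie S_lie2.
- exact: lr2_anchor.
- exact: lr2_leibniz00.
- exact: lr2_morph.
Qed.

Lemma strict_lr2_representation :
  lr_representation iota (lr2_00 S) (lr2_theta S) (lr2_01 S).
Proof.
have [l01l l01r] := lie2_bilin01 S_lie2.
split=> [//|u||X Y u].
- apply: (linear_of_restr (l01l u)) => a X; apply: oppr_inj.
  (* Homogeneity in X is only given for l10, the opposite of l01. *)
  by rewrite -scalerN -!(lie2_skew10 S_lie2); apply: lr2_leibniz10.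
- exact: lr2_leibniz01.
- exact: strict_lie2_action S_lie2 X Y u.
Qed.

Definition crossed_of_strict_lr2 : lr_crossed_on iota E M :=
  LrCrossedOn (lrc_brM := fun u v => lr2_01 S (lr2_l1 S u) v)
    strict_lr2_lie_rinehart (strict_lie2_derived S_lie2)
    strict_lr2_representation (lr2_l1_linear S)
    (fun u v => lie2_chain S_lie2 (lr2_l1 S u) v) (lie2_chain S_lie2)
    (fun u v => erefl) (@lr2_theta_l1 _ _ _ _ _ S)
    (strict_lie2_derivation S_lie2).

Lemma crossed_of_strict_lr2_corresponds :
  lr_corresponds S crossed_of_strict_lr2.
Proof. by []. Qed.

End CrossedOfStrict.

Section StrictOfCrossed.
Variable C : lr_crossed_on iota E M.

Lemma crossed_lie2 :
  strict_lie2 (L0 := restr iota E) (L1 := restr iota M)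
    (lrc_d C) (lrc_br C) (lrc_rho C) (fun u X => - lrc_rho C X u).
Proof.
have rho_rep := lrc_rep C.
apply: strict_lie2_of_action.
- exact: linear_restr (lrc_d_linear C).
- exact: lr_lie (lrc_lr C).
- split=> [u|X]; last exact: (rep_Klinear rho_rep X).
  exact: linear_restr (rep_linear rho_rep u).
- exact: (@lrc_d_rho _ _ _ _ _ C).
- by move=> u v; rewrite !lrc_rho_d; apply: lie_skew (lrc_lie C) u v.
- exact: rep_morph rho_rep.
Qed.

Lemma crossed_leibniz10 (u : M) a (X : E) :
  - lrc_rho C (a *: X) u = a *: - lrc_rho C X u.
Proof.
have [rhoZ _] := GRing.semilinear_linear (rep_linear (lrc_rep C) u).
by rewrite rhoZ scalerN.
Qed.

Definition strict_lr2_of_crossed : strict_lr2_on iota E M :=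
  StrictLr2On crossed_lie2 (lr_anchor (lrc_lr C)) (lr_leibniz (lrc_lr C))
    (rep_leibniz (lrc_rep C)) crossed_leibniz10 (lrc_d_linear C)
    (lr_morph (lrc_lr C)) (@lrc_theta_d _ _ _ _ _ C).

End StrictOfCrossed.

Lemma crossed_of_strict_lr2K : cancel crossed_of_strict_lr2 strict_lr2_of_crossed.
Proof.
move=> S; apply: strict_lr2_on_ext => //=.
by apply: funext => u; apply: funext => X; rewrite -(lie2_skew10 (lr2_lie2 S)).
Qed.

Lemma strict_lr2_of_crossedK : cancel strict_lr2_of_crossed crossed_of_strict_lr2.
Proof.
move=> C; apply: lr_crossed_on_ext => //=.
by apply: funext => u; apply: funext => v; apply: lrc_rho_d.
Qed.

End LieRinehart.

(** * Pre-Lie-Rinehart 2-algebras and crossed modules *)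

Section PreLieRinehart.
Variables (K : fieldType) (A : comPzRingType) (iota : {rmorphism K -> A}).
Variables E M : lmodType A.

Section CrossedOfStrict.
Variable S : strict_plr2_on iota E M.
Let S_prelie2 := plr2_prelie2 S.

Lemma strict_plr2_prelie_rinehart :
  prelie_rinehart iota (plr2_00 S) (plr2_theta S).
Proof.
split; first exact: strict_prelie2_prelie S_prelie2.
- exact: plr2_anchor.
- exact: plr2_leibniz00.
- exact: plr2_linear00.
- exact: plr2_morph.
Qed.

Lemma strict_plr2_representation :
  plr_representation iota (plr2_00 S) (plr2_theta S) (plr2_01 S)
    (fun X u => plr2_10 S u X).
Proof.
have [m01l m01r] := prelie2_bilin01 S_prelie2.
have [m10l m10r] := prelie2_bilin10 S_prelie2.
split=> [|X|u|X Y u].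
- split=> [//|u||X Y u].
  + by apply: (linear_of_restr (m01l u)) => a X; apply: plr2_linear01.
  + exact: plr2_leibniz01.
  + exact: strict_prelie2_rho S_prelie2 X Y u.
- by apply: (linear_of_restr (m10l X)) => a u; apply: plr2_linear10l.
- by apply: (linear_of_restr (m10r u)) => a X; apply: plr2_linear10r.
- exact: strict_prelie2_rho_mu S_prelie2 X Y u.
Qed.

Definition crossed_of_strict_plr2 : plr_crossed_on iota E M :=
  PlrCrossedOn (plrc_mulM := fun u v => plr2_01 S (plr2_m1 S u) v)
    strict_plr2_prelie_rinehart (strict_prelie2_derived S_prelie2)
    strict_plr2_representation (plr2_m1_linear S)
    (fun u v => prelie2_chain01 S_prelie2 (plr2_m1 S u) v)
    (prelie2_chain01 S_prelie2)
    (fun X u => prelie2_chain10 S_prelie2 u X)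
    (fun u v => erefl)
    (fun u v => esym (prelie2_peiffer S_prelie2 u v))
    (@plr2_theta_m1 _ _ _ _ _ S).

Lemma crossed_of_strict_plr2_corresponds :
  plr_corresponds S crossed_of_strict_plr2.
Proof. by split=> //= u v; apply: prelie2_peiffer S_prelie2 u v. Qed.

End CrossedOfStrict.

Section StrictOfCrossed.
Variable C : plr_crossed_on iota E M.
Let C_rep := plrc_rep C.
Let rho_rep := prep_rho C_rep.

Lemma crossed_prelie2 :
  strict_prelie2 (P0 := restr iota E) (P1 := restr iota M)
    (plrc_d C) (plrc_mul C) (plrc_rho C) (fun u X => plrc_mu C X u).
Proof.
apply: strict_prelie2_of_action.
- exact: linear_restr (plrc_d_linear C).
- exact: plr_prelie (plrc_plr C).
- split=> [u|X]; last exact: (rep_Klinear rho_rep X).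
  exact: linear_restr (rep_linear rho_rep u).
- split=> [X|u]; first exact: linear_restr (prep_mu_Hom C_rep X).
  exact: linear_restr (prep_mu_linear C_rep u).
- exact: (@plrc_d_rho _ _ _ _ _ C).
- by move=> u X; apply: (plrc_d_mu C).
- by move=> u v; rewrite plrc_rho_d plrc_mu_d.
- exact: rep_morph rho_rep.
- exact: prep_rho_mu C_rep.
Qed.

Definition strict_plr2_of_crossed : strict_plr2_on iota E M :=
  StrictPlr2On crossed_prelie2 (plr_anchor (plrc_plr C))
    (plr_leibniz (plrc_plr C)) (rep_leibniz rho_rep)
    (plr_linear (plrc_plr C))
    (fun a X u => GRing.scalable_linear (rep_linear rho_rep u) a X)
    (fun u => GRing.scalable_linear (prep_mu_linear C_rep u))
    (fun a u X => GRing.scalable_linear (prep_mu_Hom C_rep X) a u)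
    (plrc_d_linear C) (plr_morph (plrc_plr C)) (@plrc_theta_d _ _ _ _ _ C).

End StrictOfCrossed.

Lemma crossed_of_strict_plr2K :
  cancel crossed_of_strict_plr2 strict_plr2_of_crossed.
Proof. by move=> S; apply: strict_plr2_on_ext. Qed.

Lemma strict_plr2_of_crossedK :
  cancel strict_plr2_of_crossed crossed_of_strict_plr2.
Proof.
move=> C; apply: plr_crossed_on_ext => //=.
by apply: funext => u; apply: funext => v; apply: plrc_rho_d.
Qed.

End PreLieRinehart.

(** * The correspondences *)

Theorem theorem6p7 (K : fieldType) (A : comPzRingType)
    (iota : {rmorphism K -> A}) :
  (exists F : forall P : strict_plr2 iota,
                plr_crossed_on iota (plr2_P0 P) (plr2_P1 P),
     (forall P, plr_corresponds (plr2_str P) (F P)) /\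
     bijective (fun P => PlrCrossed (F P))) /\
  (exists G : forall L : strict_lr2 iota,
                lr_crossed_on iota (lr2_L0 L) (lr2_L1 L),
     (forall L, lr_corresponds (lr2_str L) (G L)) /\
     bijective (fun L => LrCrossed (G L))).
Proof.
split.
  exists (fun P => crossed_of_strict_plr2 (plr2_str P)); split=> [P|].
    exact: crossed_of_strict_plr2_corresponds.
  exists (fun C => StrictPlr2 (strict_plr2_of_crossed (plrc_str C))).
    by case=> P0 P1 P /=; rewrite crossed_of_strict_plr2K.
  by case=> E M C /=; rewrite strict_plr2_of_crossedK.
exists (fun L => crossed_of_strict_lr2 (lr2_str L)); split=> [L|].
  exact: crossed_of_strict_lr2_corresponds.
exists (fun C => StrictLr2 (strict_lr2_of_crossed (lrc_str C))).
  by case=> L0 L1 L /=; rewrite crossed_of_strict_lr2K.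
by case=> E M C /=; rewrite strict_lr2_of_crossedK.
Qed.
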